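(* Let $\xi\in(0,1)$ be a constant. For unit-sum valuation functions in one-sided matching with $n$ agents and $n$ items, every deterministic matching algorithm that makes at most $k$ value queries per agent, where $1\le k\le(1-\xi)n^{1/(k+1)}$, has distortion $\Omega\!\left(\frac1k n^{1/(k+1)}\right)$. The hidden constant depends only on $\xi$. This holds even on instances where all agents have the same ranking of the items.
   Context: One-sided matching: there is a set $N$ of $n$ agents and a set $A$ of $n$ items. Each agent $i$ has a valuation function $v_i:A\to\mathbb{R}_{\ge0}$ with $\sum_{j\in A}v_i(j)=1$ (unit-sum). A deterministic matching algorithm making $k$ queries per agent receives the strict rankings consistent with the values (if $a\succ_i b$ then $v_i(a)\ge v_i(b)$). It adaptively makes value queries $(i,j)\mapsto v_i(j)$, at most $k$ per agent, and outputs a bijection $Y:N\to A$. Its distortion is the supremum over unit-sum valuation profiles of $\max_Z\sum_i v_i(z_i)/\sum_i v_i(y_i)$. *)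

(* Defs.v *)
From HB Require Import structures.
From mathcomp Require Import all_boot all_order all_algebra all_fingroup.
From mathcomp Require Import all_classical all_reals all_analysis.
From mathcomp Require Import Rstruct Rstruct_topology.
Set Implicit Arguments. Unset Strict Implicit. Unset Printing Implicit Defensive.
Import Order.TTheory GRing.Theory Num.Theory.
Local Open Scope ring_scope.

Section Matching.
Variable R : realType.
Variable n : nat.

Definition agent := 'I_n.
Definition item := 'I_n.

Definition profile := agent -> item -> R.

Definition unit_sum (v : profile) : Prop :=
  (forall i j, 0 <= v i j) /\ (forall i, \sum_(j : item) v i j = 1).

(* a strict ranking of the items: sigma r = item at rank r (rank 0 = best) *)
Definition ranking := {perm item}.
Definition rankings := agent -> ranking.

Definition consistent (sigma : rankings) (v : profile) : Prop :=
  forall (i : agent) (r r' : 'I_n), (r < r')%N -> v i (sigma i r') <= v i (sigma i r).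

Definition transcript := seq (agent * item * R).

Record algorithm := Algorithm {
  next_query : rankings -> transcript -> option (agent * item);
  output : rankings -> transcript -> {perm 'I_n} (* agent i gets item Y i *)
}.

Fixpoint run (A : algorithm) (sigma : rankings) (v : profile)
    (fuel : nat) (h : transcript) : transcript :=
  match fuel with
  | 0 => h
  | f.+1 =>
    match next_query A sigma h with
    | None => h
    | Some (i, j) => run A sigma v f (rcons h (i, j, v i j))
    end
  end.

(* the transcript of the algorithm on an instance (with a fuel that is never
   exhausted for algorithms within a budget of k queries per agent) *)
Definition transcript_of (A : algorithm) (k : nat) (sigma : rankings)
    (v : profile) : transcript :=
  run A sigma v (n * k).+1 [::].

Definition nqueries (i : agent) (h : transcript) : nat :=
  count (fun q : agent * item * R => q.1.1 == i) h.

Definition within_budget (A : algorithm) (k : nat) : Prop :=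
  forall sigma v, unit_sum v -> consistent sigma v ->
    forall i, (nqueries i (transcript_of A k sigma v) <= k)%N.

Definition alg_matching (A : algorithm) (k : nat) (sigma : rankings)
    (v : profile) : {perm 'I_n} :=
  output A sigma (transcript_of A k sigma v).

Definition social_welfare (v : profile) (Y : {perm 'I_n}) : R :=
  \sum_(i : agent) v i (Y i).

Definition opt_welfare (v : profile) : R :=
  \big[Num.max/0]_(Z : {perm 'I_n}) social_welfare v Z.

(* "distortion of A (with budget k) is at least D, even restricted to instances
   in which all agents have the same ranking":
   sup over such instances of OPT/SW(A) is >= D, where the ratio is +oo when SW = 0. *)
Definition distortion_ge_common_ranking (A : algorithm) (k : nat) (D : R) : Prop :=
  forall D' : R, D' < D ->
    exists (sigma0 : ranking) (v : profile),
      [/\ unit_sum v, consistent (fun _ => sigma0) v &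
          D' * social_welfare v (alg_matching A k (fun _ => sigma0) v)
            < opt_welfare v].

End Matching.

(* Main.v *)
Require Import Defs.
From HB Require Import structures.
From mathcomp Require Import all_boot all_order all_algebra all_fingroup.
From mathcomp Require Import all_classical all_reals all_analysis.
From mathcomp Require Import Rstruct Rstruct_topology.
From mathcomp Require Import zify ring lra.
Import Order.TTheory GRing.Theory Num.Theory.
Local Open Scope ring_scope.

(** Put M = floor (n^(1/(k+1))) and cut the common ranking into k+2 consecutive
    blocks: block l <= k consists of the items of rank up to M^l not in an
    earlier block, and block k+1 of all the rest. The adversary answers every
    query in block l <= k by M^-(l+1) and every query in the last block by 0;
    these answers account for a mass of at most (k+1)/M per agent. After k
    queries each agent has an unqueried block other than the one containing its
    matched item; the remaining mass of the agent is spread evenly there, which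
    keeps the values monotone. The algorithm thus gets at most (k+1)/M. Most
    agents are matched to the last block, so by pigeonhole some block l <= k is
    raised by at least as many agents as it has items, and matching such agents
    to that block gives welfare at least 1 - (k+1)/M. When n^(1/(k+1)) <= 16 k
    the claimed bound is at most 1 and holds trivially. *)

(** * Runs and transcripts *)

Lemma run_add (R : realType) (n : nat) (A : algorithm R n) (sigma : rankings n)
    (v : profile R n) (f g : nat) (h : transcript R n) :
  run A sigma v (f + g) h = run A sigma v g (run A sigma v f h).
Proof.
elim: f h => [|f IH] h //; rewrite addSn /=.
case E: (next_query A sigma h) => [[i j]|]; first exact: IH.
by clear IH; case: g => [|g] //=; rewrite E.
Qed.

Lemma run_prefix (R : realType) (n : nat) (A : algorithm R n)
    (sigma : rankings n) (v : profile R n) (f : nat) (h : transcript R n) :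
  prefix h (run A sigma v f h).
Proof.
elim: f h => [|f IH] h /=; first exact: prefix_refl.
case: (next_query A sigma h) => [[i j]|]; last exact: prefix_refl.
by apply: prefix_trans (IH _); rewrite -cats1 prefix_prefix.
Qed.

Lemma leq_nqueries_prefix (R : realType) (n : nat) (i : agent n)
    (h h' : transcript R n) :
  prefix h h' -> (nqueries i h <= nqueries i h')%N.
Proof. by case/prefixP => s ->; rewrite /nqueries count_cat leq_addr. Qed.

(** A deterministic run is decided by the answers it receives, so agreement on the queries recorded
    under [w] propagates step by step. *)
Lemma eq_run (R : realType) (n : nat) (A : algorithm R n)
    (sigma : rankings n) (v w : profile R n) (f : nat) (h : transcript R n) :
  {in run A sigma w f h, forall q, v q.1.1 q.1.2 = w q.1.1 q.1.2} ->
  run A sigma v f h = run A sigma w f h.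
Proof.
elim: f h => [|f IH] h //=.
case: (next_query A sigma h) => [[i j]|] // Hq.
have hin : (i, j, w i j) \in run A sigma w f (rcons h (i, j, w i j)).
  have /prefixP[s ->] := run_prefix _ _ A sigma w f (rcons h (i, j, w i j)).
  by rewrite mem_cat mem_rcons inE eqxx.
have /= -> := Hq _ hin.
exact: IH.
Qed.

(** * Finite selection and comparison with the optimum *)

Lemma exists_notin_seq (s : seq nat) (m : nat) :
  (size s < m)%N -> exists2 e, (e < m)%N & e \notin s.
Proof.
move=> sm; have [|/allPn[e]] := boolP (all (mem s) (iota 0 m)).
  move=> /allP sub; have := uniq_leq_size (iota_uniq 0 m) sub.
  by rewrite size_iota leqNgt sm.
by rewrite mem_iota /= add0n => em es; exists e.
Qed.

(** Listing each set before its complement, the permutation matching equal positions sends [B] into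
    [N]. *)
Lemma exists_perm_into (n : nat) (B N : {set 'I_n}) :
  (#|B| <= #|N|)%N -> exists g : {perm 'I_n}, forall j, j \in B -> g j \in N.
Proof.
move=> leBN.
pose l (C : {set 'I_n}) := enum C ++ enum (~: C).
have lu C : uniq (l C).
  rewrite cat_uniq !enum_uniq andbT /=; apply/hasPn => x.
  by rewrite !mem_enum inE.
have lm C x : x \in l C by rewrite mem_cat !mem_enum inE orbN.
have ls C : size (l C) = n.
  by rewrite size_cat -!cardE cardsC card_ord.
have li C x : (index x (l C) < n)%N by rewrite -[X in (_ < X)%N](ls C) index_mem.
pose g j := nth j (l N) (index j (l B)).
have ginj : injective g.
  move=> x y; rewrite /g (set_nth_default y) ?ls //.
  move/eqP; rewrite nth_uniq ?lu ?ls //.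
  by move/eqP/index_inj => ->.
exists (perm ginj) => j jB; rewrite permE /g.
have jlt : (index j (l B) < #|N|)%N.
  apply: leq_trans leBN; rewrite index_cat mem_enum jB cardE index_mem.
  by rewrite mem_enum.
by rewrite nth_cat -cardE jlt -mem_enum mem_nth // -cardE.
Qed.

Lemma social_welfare_le_opt (R : realType) (n : nat) (v : profile R n)
    (Z : {perm 'I_n}) : social_welfare v Z <= opt_welfare v.
Proof. by rewrite /opt_welfare; apply: le_bigmax. Qed.

(** * Geometric blocks of ranks and their sizes *)

(** For [1 < M], [up_log M j.+1] is the least [e] with [j < M ^ e], ranks being counted from 0;
    [minn] merges everything later into block [k.+1]. *)
Definition block (M k j : nat) : nat := minn (up_log M j.+1) k.+1.

Lemma block_le (M k j e : nat) :
  (1 < M)%N -> (e <= k)%N -> (block M k j <= e)%N = (j < M ^ e)%N.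
Proof.
move=> M1 ek; rewrite /block geq_min [X in _ || X]leqNgt ltnS ek orbF.
apply/idP/idP; last exact: up_log_min.
by move=> ue; apply: leq_trans (up_logP _ M1) _; rewrite leq_exp2l.
Qed.

Lemma block_le_max (M k j : nat) : (block M k j <= k.+1)%N.
Proof. exact: geq_minr. Qed.

Lemma leq_block (M k j j' : nat) :
  (j <= j')%N -> (block M k j <= block M k j')%N.
Proof.
move=> jj; rewrite /block leq_min geq_minr andbT.
by apply: leq_trans (geq_minl _ _) _; apply: leq_up_log.
Qed.

Definition block_size (n M k l : nat) : nat :=
  #|[set j : 'I_n | block M k j == l]|.

Lemma card_ord_itv (n a b : nat) :
  (b <= n)%N -> (b - a <= #|[set j : 'I_n | (a <= j < b)%N]|)%N.
Proof.
move=> bn.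
have f_lt (x : 'I_(b - a)) : (a + x < n)%N by have := ltn_ord x; lia.
pose f x := Ordinal (f_lt x).
have finj : injective f by move=> x y [] /addnI /val_inj.
rewrite -[X in (X <= _)%N]card_ord -(card_imset predT finj).
apply: subset_leq_card; apply/fintype.subsetP => y /imsetP[x _ ->].
by rewrite inE /=; have := ltn_ord x; lia.
Qed.

Lemma block_size_le (n M k l : nat) :
  (1 < M)%N -> (l <= k)%N -> (block_size n M k l <= M ^ l)%N.
Proof.
move=> M1 lk; rewrite -[X in (_ <= X)%N]card_ord.
rewrite /block_size.
have [nM|/ltnW Mn] := leqP n (M ^ l).
  by rewrite card_ord (leq_trans (max_card _)) ?card_ord.
pose f (x : 'I_(M ^ l)) := widen_ord Mn x.
apply: leq_trans (leq_imset_card f predT).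
apply: subset_leq_card; apply/fintype.subsetP => j; rewrite inE => /eqP jl.
have jM : (j < M ^ l)%N by rewrite -(block_le M k) ?jl.
by apply/imsetP; exists (Ordinal jM) => //; apply: val_inj.
Qed.

(** All ranks in [[M ^ l, M ^ l.+1)] fall into this block; for [l = k] the cap may add more. *)
Lemma block_size_ge (n M k l : nat) :
  (1 < M)%N -> (M ^ k.+1 <= n)%N -> (l <= k)%N ->
  (M ^ l.+1 - M ^ l <= block_size n M k l.+1)%N.
Proof.
move=> M1 Mn lk.
have Mln : (M ^ l.+1 <= n)%N by apply: leq_trans Mn; rewrite leq_exp2l.
apply: leq_trans (card_ord_itv _ (M ^ l) _ Mln) _.
apply: subset_leq_card; apply/fintype.subsetP => j; rewrite !inE => /andP[lj jl].
rewrite eqn_leq ltnNge (block_le _ _ _ l) // -leqNgt lj andbT.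
have [lk1|kl1] := leqP l.+1 k; first by rewrite block_le.
by apply: leq_trans (block_le_max _ _ _) _.
Qed.

Lemma block0 (M k : nat) : (1 < M)%N -> block M k 0 = 0%N.
Proof. by move=> M1; apply/eqP; rewrite -leqn0 block_le. Qed.

Lemma block_size_gt0 (n M k l : nat) :
  (1 < M)%N -> (M ^ k.+1 <= n)%N -> (l <= k.+1)%N ->
  (0 < block_size n M k l)%N.
Proof.
move=> M1 Mn; case: l => [_|l lk].
  have n0 : (0 < n)%N by apply: leq_trans Mn; rewrite expn_gt0; lia.
  by apply/card_gt0P; exists (Ordinal n0); rewrite inE block0.
apply: leq_trans (block_size_ge _ _ _ _ M1 Mn lk).
by rewrite subn_gt0 ltn_exp2l.
Qed.

(** * Base answers and raised profiles *)

Section Adversary.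
Variables (R : realType) (n M k : nat).
Hypotheses (kM : (k.+2 <= M)%N) (Mn : (M ^ k.+1 <= n)%N).

Let M_gt1 : (1 < M)%N. Proof. by apply: leq_trans kM. Qed.
Let M_gt0 : 0 < M%:R :> R. Proof. by rewrite ltr0n; apply: ltnW. Qed.

Definition base_value (l : nat) : R :=
  if (l <= k)%N then (M%:R ^+ l.+1)^-1 else 0.

Definition base_profile : profile R n := fun _ j => base_value (block M k j).

Definition base_mass_off (l : nat) : R :=
  \sum_(j < n | block M k j != l) base_value (block M k j).

(** The even value on block [l] that completes the untouched rest to mass 1. *)
Definition raised_value (l : nat) : R :=
  (1 - base_mass_off l) / (block_size n M k l)%:R.

Definition raised_profile (b : 'I_n -> nat) : profile R n := fun i j =>
  if block M k j == b i then raised_value (b i) else base_value (block M k j).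

Lemma base_value_ge0 (l : nat) : 0 <= base_value l.
Proof.
by rewrite /base_value; case: ifP => // _; rewrite invr_ge0 exprn_ge0 // ltW.
Qed.

Lemma base_value_homo (l l' : nat) :
  (l <= l')%N -> base_value l' <= base_value l.
Proof.
move=> ll; rewrite {1}/base_value; case: ifP => [l'k|_]; last exact: base_value_ge0.
rewrite /base_value (leq_trans ll l'k) lef_pV2 ?posrE ?exprn_gt0 //.
by rewrite ler_eXn2l // ltr1n.
Qed.

Lemma sum_in_block (l : nat) (x : R) :
  \sum_(j < n | block M k j == l) x = (block_size n M k l)%:R * x.
Proof.
rewrite mulr_natl /block_size -sumr_const; apply: eq_bigl => j.
by rewrite inE.
Qed.

Lemma base_mass_block_le (l : nat) :
  (block_size n M k l)%:R * base_value l <= if (l <= k)%N then M%:R^-1 else 0.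
Proof.
rewrite /base_value; case: ifP => lk; last by rewrite mulr0.
rewrite exprS invfM mulrCA ler_piMr ?invr_ge0 ?(ltW M_gt0) //.
rewrite ler_pdivrMr ?exprn_gt0 // mul1r -natrX ler_nat.
exact: block_size_le.
Qed.

Lemma base_mass_le : \sum_(j < n) base_value (block M k j) <= k.+1%:R / M%:R.
Proof.
rewrite (partition_big (fun j : 'I_n => inord (block M k j) : 'I_k.+2) predT) //=.
have blockE (l : 'I_k.+2) (j : 'I_n) :
    (inord (block M k j) == l :> 'I_k.+2) = (block M k j == l).
  by rewrite -val_eqE /= inordK // ltnS block_le_max.
apply: (@le_trans _ _ (\sum_(l < k.+2) if (l <= k)%N then M%:R^-1 else 0)).
  apply: ler_sum => l _; apply: le_trans (base_mass_block_le l).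
  rewrite -sum_in_block (eq_bigl _ _ (blockE l)).
  by apply: ler_sum => j /eqP ->.
rewrite big_ord_recr /= ltnn addr0 (eq_bigr (fun _ => M%:R^-1)); last first.
  by move=> l _; rewrite /= -ltnS ltn_ord.
by rewrite sumr_const card_ord mulr_natl.
Qed.

Lemma base_massE (l : nat) :
  \sum_(j < n) base_value (block M k j) =
  (block_size n M k l)%:R * base_value l + base_mass_off l.
Proof.
rewrite (bigID (fun j : 'I_n => block M k j == l)) /= -sum_in_block.
by congr (_ + _); apply: eq_bigr => j /eqP ->.
Qed.

Lemma base_mass_off_le (l : nat) : base_mass_off l <= k.+1%:R / M%:R.
Proof.
apply: le_trans base_mass_le; rewrite (base_massE l) lerDr.
by rewrite mulr_ge0 ?base_value_ge0.
Qed.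

Lemma ratio_lt1 : k.+1%:R / M%:R < 1 :> R.
Proof. by rewrite ltr_pdivrMr // mul1r ltr_nat. Qed.

Lemma block_size_pos (l : nat) :
  (l <= k.+1)%N -> 0 < (block_size n M k l)%:R :> R.
Proof. by move=> lk; rewrite ltr0n block_size_gt0. Qed.

(** Raising never lowers a value: the whole base mass, the block's own share included, is at most
    (k+1)/M < 1. *)
Lemma base_le_raised (l : nat) :
  (l <= k.+1)%N -> base_value l <= raised_value l.
Proof.
move=> lk; rewrite /raised_value ler_pdivlMr ?block_size_pos // mulrC lerBrDr.
by rewrite -base_massE; apply: le_trans base_mass_le (ltW ratio_lt1).
Qed.

(* The block [l.+1] has at least [M ^ l.+1 - M ^ l] items, and the first item
   alone, outside that block, absorbs the missing mass [1 / M]. *)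
Lemma raised_le_base (l : nat) :
  (l <= k)%N -> raised_value l.+1 <= base_value l.
Proof.
move=> lk; rewrite /raised_value ler_pdivrMr ?block_size_pos //.
have n0 : (0 < n)%N by apply: leq_trans Mn; rewrite expn_gt0; lia.
have off : M%:R^-1 <= base_mass_off l.+1.
  rewrite /base_mass_off (bigD1 (Ordinal n0)) /= block0 //.
  rewrite {1}/base_value /= expr1 lerDl sumr_ge0 // => j _.
  exact: base_value_ge0.
have size_ge := block_size_ge _ _ _ _ M_gt1 Mn lk.
have Mll : (M ^ l <= M ^ l.+1)%N by rewrite leq_exp2l.
move: size_ge; rewrite -(ler_nat R) natrB // !natrX => size_ge.
apply: (@le_trans _ _ (1 - M%:R^-1)); first by rewrite lerD2l lerN2.
rewrite /base_value lk mulrC ler_pdivlMr ?exprn_gt0 //.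
apply: le_trans size_ge; by rewrite mulrBl mul1r exprS mulKf ?gt_eqF.
Qed.

Section Profile.
Variable b : 'I_n -> nat.
Hypothesis b_le : forall i, (b i <= k.+1)%N.

Lemma raised_profile_unit_sum : unit_sum (raised_profile b).
Proof.
split=> [i j|i].
  rewrite /raised_profile; case: ifP => _; last exact: base_value_ge0.
  by apply: le_trans (base_value_ge0 (b i)) _; apply: base_le_raised.
rewrite (bigID (fun j : 'I_n => block M k j == b i)) /=.
rewrite (eq_bigr (fun _ => raised_value (b i))); last first.
  by move=> j jb; rewrite /raised_profile jb.
rewrite sum_in_block /raised_value mulrC divfK ?gt_eqF ?block_size_pos //.
rewrite (eq_bigr (fun j : 'I_n => base_value (block M k j))); last first.
  by move=> j jb; rewrite /raised_profile (negbTE jb).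
by rewrite subrK.
Qed.

(** Only the edges of the raised block need care: [raised_le_base] handles the better side,
    [base_le_raised] the worse side. *)
Lemma raised_profile_consistent : consistent (fun _ => 1%g) (raised_profile b).
Proof.
move=> i r r' rr; rewrite !perm1 /raised_profile.
have := leq_block M k _ _ (ltnW rr).
case: (eqVneq (block M k r) (b i)) => [<-|rb];
  case: (eqVneq (block M k r') _) => [r'b|r'b] bb //.
- exact: le_trans (base_value_homo _ _ bb) (base_le_raised _ (block_le_max _ _ _)).
- move: (b_le i) rb bb; rewrite r'b; case: (b i) => [|l] lk rb bb.
    (* No block precedes block 0, so this case is contradictory. *)
    by move: rb bb; rewrite leqn0 => /negbTE ->.
  apply: le_trans (raised_le_base _ lk) _; apply: base_value_homo.
  by rewrite -ltnS ltn_neqAle rb.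
- exact: base_value_homo.
Qed.

(** No agent receives an item of its raised block, so the welfare is a reindexed base mass. *)
Lemma raised_welfare_le (Y : {perm 'I_n}) :
  (forall i, b i != block M k (Y i)) ->
  social_welfare (raised_profile b) Y <= k.+1%:R / M%:R.
Proof.
move=> bY; apply: le_trans base_mass_le.
rewrite [leRHS](reindex_inj (@perm_inj _ Y)) /=.
by apply: ler_sum => i _; rewrite /raised_profile eq_sym (negbTE (bY i)).
Qed.

Lemma raised_opt_ge_block (l : nat) :
  (l <= k.+1)%N -> (block_size n M k l <= #|[set i | b i == l]|)%N ->
  1 - k.+1%:R / M%:R <= opt_welfare (raised_profile b).
Proof.
move=> lk /exists_perm_into[g gP].
(* [g] sends the items of the block to agents raising it; its inverse is the matching that serves
   those agents. *)
apply: le_trans (social_welfare_le_opt _ _ _ g^-1%g).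
apply: (@le_trans _ _ (1 - base_mass_off l)).
  by rewrite lerD2l lerN2 base_mass_off_le.
have -> : 1 - base_mass_off l = \sum_(j < n | block M k j == l) raised_value l.
  by rewrite sum_in_block mulrC divfK ?gt_eqF ?block_size_pos.
rewrite /social_welfare [leRHS](reindex_inj (@perm_inj _ g)) /=.
rewrite [leRHS](bigID (fun j : 'I_n => block M k j == l)) /=.
rewrite -[leLHS]addr0; apply: lerD; last first.
  by apply: sumr_ge0 => j _; case: raised_profile_unit_sum.
apply: ler_sum => j jl; have := gP j; rewrite !inE jl => /(_ isT)/eqP bg.
by rewrite permK /raised_profile bg jl.
Qed.

(* If every block [l <= k] had fewer raising agents than items, fewer than
   [k.+1 * M ^ k] agents would raise one of them; but every agent matched to
   the last block does. *)
Lemma raised_opt_ge (Y : {perm 'I_n}) :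
  (forall i, b i != block M k (Y i)) ->
  1 - k.+1%:R / M%:R <= opt_welfare (raised_profile b).
Proof.
move=> bY.
have [/existsP[l lP]|/existsPn few] := boolP
    [exists l : 'I_k.+1, (block_size n M k l <= #|[set i | b i == l]|)%N].
  by apply: raised_opt_ge_block lP; apply: ltnW.
have size_last := block_size_ge _ _ _ _ M_gt1 Mn (leqnn k).
have cardY : block_size n M k k.+1 = #|[set i : 'I_n | block M k (Y i) == k.+1]|.
  rewrite -(card_imset _ (@perm_inj _ Y)) /block_size; apply: eq_card => j.
  rewrite inE; apply/idP/imsetP => [jk|[i]]; last by rewrite inE => ik ->.
  by exists (Y^-1 j)%g; rewrite ?inE permKV.
have sub : [set i : 'I_n | block M k (Y i) == k.+1] \subset
    \bigcup_(l < k.+1) [set i | b i == l].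
  apply/fintype.subsetP => i; rewrite inE => /eqP Yi.
  have bk : (b i < k.+1)%N by rewrite ltn_neqAle b_le -{1}Yi bY.
  by apply/bigcupP; exists (Ordinal bk); rewrite ?inE.
have card_le : (#|\bigcup_(l < k.+1) [set i | b i == l]| <=
    \sum_(l < k.+1) #|[set i | b i == l]|)%N.
  elim/big_rec2: _ => [|l x A _ IH]; first by rewrite cards0.
  by apply: leq_trans (leq_card_setU _ _) _; rewrite leq_add2l.
have sum_lt : (\sum_(l < k.+1) #|[set i | b i == l]| <= k.+1 * (M ^ k).-1)%N.
  rewrite -[X in (_ <= X * _)%N]card_ord -sum_nat_const; apply: leq_sum => l _.
  have := few l; rewrite -ltnNge => fl.
  have sl := block_size_le n M k l M_gt1 (ltn_ord l).
  have : (M ^ l <= M ^ k)%N by rewrite leq_exp2l // -ltnS ltn_ord.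
  lia.
have Mk0 : (0 < M ^ k)%N by rewrite expn_gt0; lia.
have := leq_trans (subset_leq_card sub) (leq_trans card_le sum_lt).
(* [k.+2 <= M] gives M^(k+1) - M^k >= (k+1) M^k, contradicting the count. *)
move: size_last; rewrite -cardY expnS; nia.
Qed.
End Profile.

(** * Indistinguishability and the query budget *)

Definition queried_blocks (h : transcript R n) (i : 'I_n) : seq nat :=
  [seq block M k (val q.1.2) | q : agent n * item n * R <- h & q.1.1 == i].

Lemma size_queried_blocks (h : transcript R n) (i : 'I_n) :
  size (queried_blocks h i) = nqueries i h.
Proof. by rewrite size_map size_filter. Qed.

Lemma run_raised (A : algorithm R n) (sigma : rankings n) (f : nat)
    (b : 'I_n -> nat) :
  (forall i, b i \notin queried_blocks (run A sigma base_profile f [::]) i) ->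
  run A sigma (raised_profile b) f [::] = run A sigma base_profile f [::].
Proof.
move=> bq; apply: eq_run => q qh; rewrite /raised_profile.
case: eqP => // qb; case/negP: (bq q.1.1).
by rewrite -qb; apply/mapP; exists q => //; rewrite mem_filter eqxx.
Qed.

(* The base profile is not unit-sum, so the budget does not apply to it
   directly. But as long as every agent has made at most [k.+1] queries, it has
   an unqueried block to raise, and the run coincides with a run on a unit-sum
   profile. *)
Lemma base_run_budget (A : algorithm R n) (f : nat) :
  within_budget A k -> (f <= (n * k).+1)%N ->
  forall i, (nqueries i (run A (fun _ => 1%g) base_profile f [::]) <= k)%N.
Proof.
move=> budget; elim: f => [|f IH] fnk //.
set h := run A _ _ f.+1 _.
have hk1 i : (nqueries i h <= k.+1)%N.
  rewrite /h -addn1 run_add /=; have := IH (ltnW fnk) i.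
  case: (next_query _ _ _) => [[i' j']|] hk; last exact: leq_trans hk _.
  rewrite /nqueries -cats1 count_cat /= addn0 -addn1.
  by apply: leq_add hk _; case: eqP.
have pick i : exists l, (l <= k.+1)%N /\ l \notin queried_blocks h i.
  have [|l lk lq] := exists_notin_seq (queried_blocks h i) k.+2.
    by rewrite size_queried_blocks ltnS.
  by exists l.
have [b bP] := fin_all_exists pick.
have bk i : (b i <= k.+1)%N by have [] := bP i.
move=> i; apply: leq_trans (budget _ _ (raised_profile_unit_sum _ bk)
  (raised_profile_consistent _ bk) i).
apply: leq_nqueries_prefix.
(* Extra fuel only lengthens a transcript, so the budget of the full raised run bounds this
   prefix. *)
rewrite /transcript_of -(subnKC fnk) run_add run_raised; last first.
  by move=> i'; have [] := bP i'.
exact: run_prefix.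
Qed.

(** The base run fixes the output first; the raised blocks are chosen afterwards, avoiding what was
    queried or matched. *)
Lemma adversary (A : algorithm R n) : within_budget A k ->
  exists v : profile R n,
    [/\ unit_sum v, consistent (fun _ => 1%g) v,
      social_welfare v (alg_matching A k (fun _ => 1%g) v) <= k.+1%:R / M%:R &
      1 - k.+1%:R / M%:R <= opt_welfare v].
Proof.
move=> budget; set h := transcript_of A k (fun _ => 1%g) base_profile.
pose Y := output A (fun _ => 1%g) h.
have pick i : exists l,
    [/\ (l <= k.+1)%N, l != block M k (Y i) & l \notin queried_blocks h i].
  (* At most k queried blocks and the matched one leave one of the k+2 free. *)
  have [|l lk] := exists_notin_seq (block M k (Y i) :: queried_blocks h i) k.+2.
    by rewrite /= size_queried_blocks !ltnS; apply: base_run_budget.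
  by rewrite inE negb_or => /andP[lY lq]; exists l.
have [b bP] := fin_all_exists pick.
have bk i : (b i <= k.+1)%N by have [] := bP i.
have bY i : b i != block M k (Y i) by have [] := bP i.
exists (raised_profile b).
have -> : alg_matching A k (fun _ => 1%g) (raised_profile b) = Y.
  rewrite /alg_matching /transcript_of run_raised // => i.
  by have [] := bP i.
split; [exact: raised_profile_unit_sum|exact: raised_profile_consistent|
  exact: raised_welfare_le|exact: raised_opt_ge bY].
Qed.
End Adversary.

(** * The trivial range and the choice of constants *)

Lemma uniform_unit_sum (R : realType) (n : nat) :
  (0 < n)%N -> unit_sum (fun (_ : agent n) (_ : item n) => n%:R^-1 : R).
Proof.
move=> n0; split=> [i j|i]; first by rewrite invr_ge0 ler0n.
rewrite sumr_const card_ord -[X in X *+ _]mul1r -mulrnAl divff //.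
by rewrite pnatr_eq0 -lt0n.
Qed.

(** On the uniform profile every matching has welfare 1, hence is optimal. *)
Lemma distortion_ge_le1 (R : realType) (n k : nat) (A : algorithm R n) (D : R) :
  (0 < n)%N -> D <= 1 -> distortion_ge_common_ranking A k D.
Proof.
move=> n0 D1 D' D'D; have [_ v_sum] := uniform_unit_sum R _ n0.
pose v := fun (_ : agent n) (_ : item n) => n%:R^-1 : R.
exists 1%g, v; split; [exact: uniform_unit_sum|by move=> i r r' _; exact: lexx|].
have swE Z : social_welfare v Z = 1 by exact: (v_sum (Ordinal n0)).
rewrite swE mulr1 (lt_le_trans (lt_le_trans D'D D1)) //.
by rewrite -(swE 1%g) social_welfare_le_opt.
Qed.

Theorem theorem6 (xi : Rdefinitions.R) (hxi : 0 < xi < 1) :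
  exists c : Rdefinitions.R, 0 < c /\
    forall (n k : nat), (1 <= k)%N ->
      k%:R <= (1 - xi) * (n%:R `^ (k.+1%:R)^-1) ->
      forall A : algorithm Rdefinitions.R n, within_budget A k ->
        distortion_ge_common_ranking A k
          (c * (k%:R)^-1 * (n%:R `^ (k.+1%:R)^-1)).
Proof.
(* 1/16 makes the bound at most 1 when n^(1/(k+1)) <= 16 k, and otherwise M >= 16 k. *)
exists 16^-1; split; first by rewrite invr_gt0.
move=> n k k1 hk A budget.
set m := n%:R `^ _ in hk *.
have kR : 1 <= k%:R :> Rdefinitions.R by rewrite ler1n.
have k0 : 0 < k%:R :> Rdefinitions.R by apply: lt_le_trans kR.
have m0 : 0 <= m by exact: powR_ge0.
have n0 : (0 < n)%N.
  (* For n = 0 the power is 0, which [hk] forbids since k >= 1. *)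
  rewrite lt0n; apply/eqP => nE; move: hk; rewrite /m nE powR0.
    by rewrite mulr0 leNgt k0.
  by rewrite invr_eq0 pnatr_eq0.
have DE : 16^-1 * k%:R^-1 * m = m / (16 * k%:R) by rewrite invfM mulrC.
rewrite DE.
have [m_small|m_big] := leP m (16 * k%:R).
  by apply: distortion_ge_le1 => //; rewrite ler_pdivrMr ?mul1r ?mulr_gt0.
have /andP[Mm mM] := truncn_itv m0; move: Mm mM; set M := Num.trunc m => Mm mM.
have kM : (16 * k <= M)%N.
  by rewrite -ltnS -(ltr_nat Rdefinitions.R) natrM (lt_trans m_big).
have Mn : (M ^ k.+1 <= n)%N.
  rewrite -(ler_nat Rdefinitions.R) natrX.
  have -> : n%:R = m ^+ k.+1.
    by rewrite -powR_mulrn // /m -powRrM mulVf ?pnatr_eq0 // powRr1.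
  by rewrite lerXn2r ?nnegrE.
have kM2 : (k.+2 <= M)%N by lia.
have [v [v_sum v_cons sw opt]] := adversary _ _ _ _ kM2 Mn _ budget.
move=> D' D'D; exists 1%g, v; split => //; apply: lt_le_trans opt.
set SW := social_welfare _ _ in sw *.
have SW0 : 0 <= SW by apply: sumr_ge0 => i _; case: v_sum.
have M0 : 0 < M%:R :> Rdefinitions.R by rewrite ltr0n; lia.
have kMR : 16 * k%:R <= M%:R :> Rdefinitions.R by rewrite -natrM ler_nat.
have ratio : k.+1%:R / M%:R <= 8^-1 :> Rdefinitions.R.
  rewrite ler_pdivrMr // -natr1; lra.
(* The product estimate below needs [D'] nonnegative. *)
have [D'0|D'0] := leP D' 0.
  apply: (@le_lt_trans _ _ 0); first by rewrite mulr_le0_ge0.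
  lra.
(* m < M + 1 <= 2 M turns the constant 16 into 8. *)
have D'M : D' <= M%:R / (8 * k%:R).
  apply: le_trans (ltW D'D) _.
  rewrite ler_pdivlMr ?mulr_gt0 // mulrAC ler_pdivrMr ?mulr_gt0 //.
  move: mM; rewrite -natr1; nra.
apply: (@le_lt_trans _ _ (M%:R / (8 * k%:R) * (k.+1%:R / M%:R))).
  by apply: ler_pM => //; apply: ltW.
(* (k+1)/(8k) <= 1/4 since k >= 1, while [ratio] makes 1 - (k+1)/M at least 7/8. *)
apply: (@le_lt_trans _ _ 4^-1); last lra.
have -> : M%:R / (8 * k%:R) * (k.+1%:R / M%:R) = k.+1%:R / (8 * k%:R) :> Rdefinitions.R.
  by field; rewrite !gt_eqF.
rewrite ler_pdivrMr ?mulr_gt0 // -natr1; lra.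
Qed.
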